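(* Let $N=p_1^{2a_1}p_2^{2a_2}\cdots p_t^{2a_t}=m^2$, where $p_1,\ldots,p_t$ are distinct primes and $a_1,\ldots,a_t$ are positive integers. If $N$ is quasiperfect, then there exists an index $j$ such that $p_j\equiv 1\pmod{4}$ and $2a_j+1$ does not have a (positive) divisor congruent to $5\pmod{8}$. Moreover, if $N=(p_1p_2\cdots p_t)^{2a}=m^2$ is quasiperfect, where $p_1,\ldots,p_t$ are distinct primes and $a$ is a positive integer, then: (a) all prime factors of $N$ are congruent to $1$ or $7\pmod{8}$; (b) $2a+1\equiv 3\pmod{8}$ and all prime factors of $2a+1$ are congruent to $1$ or $3\pmod{8}$; (c) $2a+1$ is divisible by $3$.
   Context: $\sigma(N)$ denotes the sum of the positive divisors of $N$. A positive integer $N$ is called quasiperfect if $\sigma(N)=2N+1$. *)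

(* Defs.v *)
From mathcomp Require Import all_boot.

Set Implicit Arguments.
Unset Strict Implicit.
Unset Printing Implicit Defensive.

Definition sigma (N : nat) : nat := \sum_(d <- divisors N) d.

Definition quasiperfect (N : nat) : Prop := 0 < N /\ sigma N = 2 * N + 1.

(* Main.v *)
(** All divisors of a number [2 * m ^ 2 + 1] are 1 or 3 modulo 8, and
    [sigma (m ^ 2)] is the product of the geometric sums
    [1 + p + ... + p ^ (2 * a)] over [p ^ (2 * a) || m ^ 2], each of which is a
    multiple of [1 + p + ... + p ^ (d - 1)] for [d %| 2 * a + 1].  Evaluating
    these sums modulo 8 restricts [p] and [d].  Since the product is 3 modulo 8,
    one factor is 3 modulo 8, and this factor gives the index [j].  When all
    exponents are equal, [3] cannot divide [m], so that [3 %| 2 * m ^ 2 + 1]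
    and some geometric sum is divisible by 3, which forces [3 %| 2 * a + 1];
    taking [d = 3] then excludes all primes other than 1 and 7 modulo 8. *)

Require Import Defs.
From mathcomp Require Import all_boot zify.

Set Implicit Arguments.
Unset Strict Implicit.
Unset Printing Implicit Defensive.

(** * Geometric sums and the divisor sum *)

Definition geom (p n : nat) : nat := \sum_(i < n) p ^ i.

Lemma geomS p n : geom p n.+1 = geom p n + p ^ n.
Proof. by rewrite /geom big_ord_recr. Qed.

Lemma geomD p m n : geom p (m + n) = geom p m + p ^ m * geom p n.
Proof.
elim: n => [|n IHn]; first by rewrite /geom big_ord0 muln0 !addn0.
by rewrite addnS !geomS IHn expnD mulnDr addnA.
Qed.

Lemma geom_dvd p d n : d %| n -> geom p d %| geom p n.
Proof.
case/dvdnP=> k ->; elim: k => [|k IHk]; first by rewrite /geom mul0n big_ord0.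
by rewrite mulSn geomD dvdn_add // dvdn_mull.
Qed.

(** Multiplication maps pairs of divisors of [m] and [n] bijectively onto the divisors of [m * n]:
    by coprimality, the gcds of a divisor with [m] and with [n] recover the pair. *)
Lemma sigmaM m n : 0 < m -> 0 < n -> coprime m n ->
  sigma (m * n) = sigma m * sigma n.
Proof.
move=> m_gt0 n_gt0 co_mn; rewrite /sigma big_distrlr /=.
rewrite -(big_allpairs_dep (h := muln) (F := id)) /=.
apply/perm_big/uniq_perm; first exact: divisors_uniq.
  apply: allpairs_uniq; try exact: divisors_uniq.
  move=> [d1 e1] [d2 e2] /allpairsP[[x y]] /= [xm yn [-> ->]].
  move=> /allpairsP[[z w]] /= [zm wn [-> ->]].
  rewrite -!dvdn_divisors // in xm yn zm wn => Exy.
  have gcd_l u v : u %| m -> v %| n -> gcdn (u * v) m = u.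
    move=> um vn; rewrite gcdnC Gauss_gcdl; first exact/gcdn_idPr.
    exact: coprime_dvdr co_mn.
  have gcd_r u v : u %| m -> v %| n -> gcdn (u * v) n = v.
    move=> um vn; rewrite gcdnC Gauss_gcdr; first exact/gcdn_idPr.
    by apply: coprime_dvdr um _; rewrite coprime_sym.
  congr (_, _); first by rewrite -(gcd_l x y) // Exy gcd_l.
  by rewrite -(gcd_r x y) // Exy gcd_r.
move=> d; rewrite -dvdn_divisors ?muln_gt0 ?m_gt0 //.
apply/idP/allpairsP => [d_mn | [[x y] /= [xm yn ->]]].
  exists (gcdn d m, gcdn d n) => /=; rewrite -!dvdn_divisors // !dvdn_gcdr.
  split=> //; apply/eqP; rewrite eqn_dvd; apply/andP; split.
    by rewrite muln_gcdl dvdn_gcd dvdn_mulr //= muln_gcdr dvdn_gcd dvdn_mull.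
  rewrite Gauss_dvd ?dvdn_gcdl //.
  exact: coprime_dvdl (dvdn_gcdr _ _) (coprime_dvdr (dvdn_gcdr _ _) co_mn).
by rewrite -!dvdn_divisors // in xm yn; apply: dvdn_mul.
Qed.

Lemma sigma_pfactor p k : prime p -> sigma (p ^ k) = geom p k.+1.
Proof.
move=> p_pr; rewrite /sigma /geom -(big_mkord xpredT (fun i => p ^ i)).
rewrite -(big_map (fun i => p ^ i) xpredT id).
apply/perm_big/uniq_perm; first exact: divisors_uniq.
  by rewrite map_inj_uniq ?iota_uniq //; apply/expnI/prime_gt1.
move=> d; rewrite -dvdn_divisors ?expn_gt0 ?prime_gt0 //.
apply/dvdn_pfactor/mapP => // [] [i]; last first.
  by rewrite mem_index_iota => /andP[_ lt_ik] ->; exists i.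
by move=> le_ik ->; exists i; rewrite ?mem_index_iota.
Qed.

Lemma sigma_prod t (p e : 'I_t -> nat) :
  (forall i, prime (p i)) -> injective p ->
  sigma (\prod_(i < t) p i ^ e i) = \prod_(i < t) geom (p i) (e i).+1.
Proof.
move=> p_pr p_inj.
(* The induction runs over a duplicate-free list of indices, so that the prime split off differs
   from all those in the tail. *)
have: uniq (index_enum 'I_t) by exact: index_enum_uniq.
elim: (index_enum _) => [|i s IHs] /=; first by rewrite !big_nil /sigma big_seq1.
case/andP=> i_s /IHs; rewrite !big_cons => <-.
have gt0 j : 0 < p j ^ e j by rewrite expn_gt0 prime_gt0.
rewrite sigmaM ?sigma_pfactor ?prodn_gt0 //.
rewrite big_seq; elim/big_ind: _ => [|x y|j j_s]; first exact: coprimen1.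
  by rewrite coprimeMr => -> ->.
apply/coprimeXl/coprimeXr; rewrite prime_coprime // dvdn_prime2 //.
by apply: contraNneq i_s => /p_inj ->.
Qed.

(** * Divisors of [2 * m ^ 2 + 1] modulo 8 *)

(* Descent: reduce [y] to an odd residue below [n]; the cofactor of [n] in
   [y ^ 2 + 2], which is 3 modulo 8, is then smaller than [n]. *)
Lemma dvdn_sqr_add2_mod8 n y : odd n -> n %| y ^ 2 + 2 ->
  n %% 8 = 1 \/ n %% 8 = 3.
Proof.
elim/ltn_ind: n y => n IHn y odd_n n_dv.
have [n_le1 | n_gt1] := leqP n 1; first by left; have -> : n = 1 by lia.
have [z [z_lt odd_z z_dv]] : exists z, [/\ z < n, odd z & n %| z ^ 2 + 2].
  have r_dv : n %| (y %% n) ^ 2 + 2 by rewrite /dvdn -modnDml modnXm modnDml.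
  have r_lt : y %% n < n by rewrite ltn_mod; lia.
  case odd_r: (odd (y %% n)); first by exists (y %% n).
  have r_gt0 : 0 < y %% n.
    (* A zero residue would give [n %| 2], impossible for odd [n > 1]. *)
    case: posnP => // r0; move: r_dv; rewrite r0 => /dvdn_leq /=; lia.
  exists (n - y %% n); split; [lia | by rewrite oddB ?odd_n ?odd_r // ltnW |].
  (* Adding the multiple [n * (y %% n)] of [n] cancels part of the cross term, so that no
     subtraction is left outside [n - y %% n]. *)
  have <- : n %| (n - y %% n) ^ 2 + 2 + n * (y %% n) =
            (n %| (n - y %% n) ^ 2 + 2) by rewrite dvdn_addl // dvdn_mulr.
  have -> : (n - y %% n) ^ 2 + 2 + n * (y %% n) =
            n * (n - y %% n) + ((y %% n) ^ 2 + 2) by nia.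
  by rewrite dvdn_addr // dvdn_mulr.
have [k def_k] := dvdnP z_dv.
have k_lt : k < n by rewrite -(ltn_pmul2r (ltnW n_gt1)) -def_k; nia.
have nk3 : (k * n) %% 8 = 3.
  rewrite -def_k; have -> : z = z./2.*2.+1 by lia.
  (* For [z = 2w + 1], [z ^ 2 = 4w(w + 1) + 1] with [w(w + 1)] even, so [z ^ 2] is 1 modulo 8. *)
  have : ~~ odd (z./2 * (z./2 + 1)) by rewrite oddM oddD; case: odd.
  nia.
have k_odd : odd k by lia.
have k_dv : k %| z ^ 2 + 2 by rewrite def_k dvdn_mulr.
move: nk3; rewrite -modnMm; case: (IHn k k_lt z k_odd k_dv) => ->.
  by rewrite mul1n modn_mod; right.
have: n %% 8 < 8 by rewrite ltn_mod.
by case: (n %% 8) => [|[|[|[|[|[|[|[|]]]]]]]] //; left.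
Qed.

Definition one_or_three_mod8 (n : nat) : bool := (n %% 8 == 1) || (n %% 8 == 3).

Lemma dvdn_double_sqr_add1_mod8 d m : d %| 2 * m ^ 2 + 1 -> one_or_three_mod8 d.
Proof.
move=> d_dv.
have odd_d : odd d by apply: dvdn_odd d_dv _; rewrite addn1 /= oddM.
have : d %| (2 * m) ^ 2 + 2.
  have -> : (2 * m) ^ 2 + 2 = 2 * (2 * m ^ 2 + 1) by lia.
  exact: dvdn_mull.
by case/(dvdn_sqr_add2_mod8 odd_d) => d8; rewrite /one_or_three_mod8 d8.
Qed.

(** * Residues of geometric sums modulo 8 and 3 *)

Lemma odd_mod8 n : odd n -> [\/ n %% 8 = 1, n %% 8 = 3, n %% 8 = 5 | n %% 8 = 7].
Proof.
move=> odd_n; have: odd (n %% 8) by rewrite odd_mod.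
have: n %% 8 < 8 by rewrite ltn_mod.
case: (n %% 8) => [|[|[|[|[|[|[|[|]]]]]]]] // _ _;
  by [apply: Or41 | apply: Or42 | apply: Or43 | apply: Or44].
Qed.

Lemma sqr_odd_mod8 p : odd p -> p ^ 2 %% 8 = 1.
Proof. by move=> odd_p; rewrite -modnXm; case: (odd_mod8 odd_p) => ->. Qed.

(** Since [p ^ 2] is 1 modulo 8, each pair of consecutive terms after the initial 1 contributes
    [p + 1]. As [p + 1] is even, four such pairs vanish modulo 8, so only [n %% 8] matters. *)
Lemma geom_odd_mod8 p n : odd p -> odd n ->
  geom p n %% 8 = (1 + (n %% 8)./2 * (p %% 8 + 1)) %% 8.
Proof.
move=> odd_p odd_n.
have geomE b : geom p b.*2.+1 = 1 + b * (p + 1) %[mod 8].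
  elim: b => [|b IHb]; first by rewrite geomS /geom big_ord0.
  have even_exp c : p ^ c.*2 = 1 %[mod 8].
    by rewrite -mul2n expnM -modnXm sqr_odd_mod8 // exp1n.
  have odd_exp : p ^ b.*2.+1 = p %[mod 8].
    by rewrite expnS -modnMmr even_exp modnMmr muln1.
  rewrite doubleS 2!geomS -doubleS -modnDm even_exp modnDm.
  rewrite -modnDml -(modnDm (geom _ _)) IHb odd_exp modnDm modnDml.
  by congr (_ %% 8); lia.
have def_n : n = n./2.*2.+1 by lia.
rewrite {1}def_n geomE.
have -> : n./2 = 4 * (n %/ 8) + (n %% 8)./2 by lia.
have [c def_c] : exists c, p %% 8 + 1 = 2 * c.
  by case: (odd_mod8 odd_p) => ->; [exists 1 | exists 2 | exists 3 | exists 4].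
have -> : p + 1 = 8 * (p %/ 8) + 2 * c by rewrite -def_c; lia.
rewrite def_c; set q := n %/ 8; set r := (n %% 8)./2; set u := p %/ 8.
have -> : 1 + (4 * q + r) * (8 * u + 2 * c) =
          ((4 * q + r) * u + q * c) * 8 + (1 + r * (2 * c)) by lia.
by rewrite modnMDl.
Qed.

Lemma geom_two_mod8 n : 2 < n -> geom 2 n %% 8 = 7.
Proof.
(* The first three terms give 1 + 2 + 4 = 7; the rest is a multiple of 8. *)
case: n => [|[|[|n]]] // _; rewrite -(addn3 n) addnC geomD.
by rewrite /geom !big_ord_recl big_ord0 -modnDmr modnMr.
Qed.

(** Modulo 3, the sum is [n] if [p] is 1; if [p] is 2, the terms alternate between 1 and -1, and an
    odd number of them sums to 1. *)
Lemma dvdn3_geom_odd p n : prime p -> p != 3 -> odd n ->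
  3 %| geom p n -> 3 %| n.
Proof.
move=> p_pr p_neq3 odd_n.
have p3 : p %% 3 != 0 by rewrite -/(dvdn 3 p) dvdn_prime2 // eq_sym.
have geomE b : geom p b = (if p %% 3 == 1 then b else odd b) %[mod 3].
  elim: b => [|b IHb]; first by rewrite /geom big_ord0; case: ifP.
  rewrite geomS -modnDm IHb -modnXm.
  have : p %% 3 < 3 by rewrite ltn_mod.
  case: (p %% 3) p3 => [|[|[|]]] //= _ _.
    by rewrite exp1n modnDm addn1.
  rewrite -[b in 2 ^ b]odd_double_half expnD -mul2n expnM.
  have pow4 : (2 ^ 2) ^ b./2 = 1 %[mod 3] by rewrite -modnXm exp1n.
  by rewrite -(modnMmr (2 ^ _)) pow4; case: odd.
by rewrite /dvdn geomE; case: ifP; rewrite // odd_n.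
Qed.

(** * Quasiperfect squares with arbitrary even exponents *)

Section QuasiperfectSquare.

Variables (t : nat) (p a : 'I_t -> nat) (m : nat).
Hypotheses (p_pr : forall i, prime (p i)) (p_inj : injective p).
Hypothesis a_gt0 : forall i, 0 < a i.
Hypothesis sqr_m : m ^ 2 = \prod_(i < t) p i ^ (2 * a i).
Hypothesis qp_m : quasiperfect (m ^ 2).

Let geom_prod :
  2 * m ^ 2 + 1 = \prod_(i < t) geom (p i) (2 * a i).+1.
Proof. by case: qp_m => _ <-; rewrite sqr_m sigma_prod. Qed.

Lemma geom_factor_mod8 i d : d %| (2 * a i).+1 ->
  one_or_three_mod8 (geom (p i) d).
Proof.
move=> d_dv; apply: (@dvdn_double_sqr_add1_mod8 _ m).
apply: dvdn_trans (geom_dvd (p i) d_dv) _.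
by rewrite geom_prod (bigD1 i) // dvdn_mulr.
Qed.

Lemma odd_factor i : odd (p i).
Proof.
have [p2 | //] := even_prime (p_pr i).
move: (geom_factor_mod8 (dvdnn (2 * a i).+1)).
by rewrite /one_or_three_mod8 p2 geom_two_mod8 //; move: (a_gt0 i); lia.
Qed.

Lemma geom_factor_mod8E i d : d %| (2 * a i).+1 ->
  one_or_three_mod8 (1 + (d %% 8)./2 * (p i %% 8 + 1)).
Proof.
move=> d_dv; move: (geom_factor_mod8 d_dv).
rewrite /one_or_three_mod8 geom_odd_mod8 ?odd_factor //.
by apply: dvdn_odd d_dv _; rewrite /= oddM.
Qed.

Lemma prime_dvdn_sqr q : prime q -> q %| m ^ 2 -> exists i, q = p i.
Proof.
move=> q_pr; rewrite sqr_m; elim/big_ind: _ => [|x y IHx IHy|i _].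
- by rewrite dvdn1 => /eqP q1; rewrite q1 in q_pr.
- by rewrite Euclid_dvdM // => /orP[].
- by rewrite Euclid_dvdX // dvdn_prime2 // => /andP[/eqP-> _]; exists i.
Qed.

Lemma exists_geom_factor3 : exists j, geom (p j) (2 * a j).+1 %% 8 = 3.
Proof.
have [/existsP[j /eqP] | no3] :=
  boolP [exists j, geom (p j) (2 * a j).+1 %% 8 == 3]; first by exists j.
have m_odd : odd m.
  apply/negPn/negP; rewrite -dvdn2 => m_even.
  have [|i p2] := @prime_dvdn_sqr 2 isT; first by rewrite dvdn_exp.
  by move: (odd_factor i); rewrite -p2.
have : (2 * m ^ 2 + 1) %% 8 = 1.
  rewrite geom_prod; elim/big_ind: _ => // [x y x1 y1|i _].
    by rewrite -modnMm x1 y1.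
  have /orP[/eqP // | i3] := geom_factor_mod8 (dvdnn (2 * a i).+1).
  by case/existsP: no3; exists i.
(* For odd [m], however, [2 * m ^ 2 + 1] is 3 modulo 8. *)
by rewrite -modnDml -modnMmr sqr_odd_mod8.
Qed.

Lemma exists_dvdn3_exponent : (forall i, p i != 3) ->
  exists j, 3 %| (2 * a j).+1.
Proof.
move=> p_neq3.
have m3 : ~~ (3 %| m).
  apply/negP => m3; have [|i p3] := @prime_dvdn_sqr 3 isT.
    by rewrite dvdn_exp.
  by move: (p_neq3 i); rewrite -p3.
have : 3 %| 2 * m ^ 2 + 1.
  rewrite /dvdn -modnDml -modnMmr -modnXm.
  move: m3; rewrite /dvdn; have : m %% 3 < 3 by rewrite ltn_mod.
  by case: (m %% 3) => [|[|[|]]].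
rewrite geom_prod => dv3.
have [j j3] : exists j, 3 %| geom (p j) (2 * a j).+1.
  move: dv3; elim/big_ind: _ => [//|x y IHx IHy|i _]; last by exists i.
  by rewrite Euclid_dvdM // => /orP[].
by exists j; apply: dvdn3_geom_odd j3; rewrite //= oddM.
Qed.

Lemma exists_factor_mod8 : exists j,
  p j %% 8 = 1 /\ (2 * a j).+1 %% 8 = 3 \/
  p j %% 8 = 5 /\ (2 * a j).+1 %% 8 = 7.
Proof.
have [j j3] := exists_geom_factor3; exists j; move: j3.
have odd_e : odd (2 * a j).+1 by rewrite /= oddM.
rewrite geom_odd_mod8 ?odd_factor //.
(* Among the sixteen pairs of odd residues of [p j] and the number of terms, only (1, 3) and (5, 7)
   give a sum that is 3 modulo 8. *)
by case: (odd_mod8 (odd_factor j)) (odd_mod8 odd_e) => -> [] -> //= _; auto.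
Qed.

Lemma exists_factor_mod4 : exists j,
  p j = 1 %[mod 4] /\
  ~ (exists d : nat, d %| 2 * a j + 1 /\ d = 5 %[mod 8]).
Proof.
have [j j8] := exists_factor_mod8; exists j.
rewrite -(modn_dvdm (p j) (isT : 4 %| 8)); split.
  by case: j8 => -[-> _].
(* For [d] equal to 5 modulo 8 the partial sum is [1 + 2 * (p j + 1)], which is 5 modulo 8 whether
   [p j] is 1 or 5. *)
case=> d []; rewrite addn1 => /geom_factor_mod8E + d5.
by rewrite d5; case: j8 => -[-> _].
Qed.

(** * Equal exponents *)

Section EqualExponents.

Variable b : nat.
Hypothesis a_const : forall i, a i = b.

Lemma exponent_mod8 : (2 * b).+1 %% 8 = 3 \/ (2 * b).+1 %% 8 = 7.
Proof. by have [j] := exists_factor_mod8; rewrite a_const; case=> -[]; auto. Qed.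

Lemma dvdn3_exponent : 3 %| (2 * b).+1.
Proof.
suff /exists_dvdn3_exponent[j] : forall i, p i != 3 by rewrite a_const.
(* If 3 were one of the primes, its full geometric sum would be 1 + 4 or 1 + 12, hence 5 modulo
   8. *)
move=> i; apply/eqP => p3; have := geom_factor_mod8E (dvdnn (2 * a i).+1).
by rewrite a_const p3; case: exponent_mod8 => ->.
Qed.

(** The three-term sum [1 + p + p ^ 2] is [p + 2] modulo 8, and must be 1 or 3. *)
Lemma factor_mod8 i : p i %% 8 = 1 \/ p i %% 8 = 7.
Proof.
have := @geom_factor_mod8E i 3; rewrite a_const => /(_ dvdn3_exponent).
by case: (odd_mod8 (odd_factor i)) => -> //; auto.
Qed.

Lemma exists_factor_mod8_1 : exists2 j, p j %% 8 = 1 & (2 * b).+1 %% 8 = 3.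
Proof.
have [j] := exists_factor_mod8; rewrite a_const => j8; exists j.
  by case: j8 (factor_mod8 j) => -[->] // _ [].
by case: j8 (factor_mod8 j) => -[->] // _ [].
Qed.

(** For a prime that is 1 modulo 8, the sum of [d] terms is [d] itself modulo 8. *)
Lemma dvdn_exponent_mod8 d : d %| (2 * b).+1 -> d %% 8 = 1 \/ d %% 8 = 3.
Proof.
move=> d_dv; have [j j1 _] := exists_factor_mod8_1.
have odd_d : odd d by apply: dvdn_odd d_dv _; rewrite /= oddM.
have := @geom_factor_mod8E j d; rewrite a_const j1 => /(_ d_dv).
by case: (odd_mod8 odd_d) => -> //; auto.
Qed.

End EqualExponents.

End QuasiperfectSquare.

Theorem theorem1p1 :
  (forall (t : nat) (p a : 'I_t -> nat) (N m : nat),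
     (forall i, prime (p i)) ->
     injective p ->
     (forall i, 0 < a i) ->
     N = \prod_(i < t) p i ^ (2 * a i) ->
     N = m ^ 2 ->
     quasiperfect N ->
     exists j : 'I_t,
       p j = 1 %[mod 4] /\
       ~ (exists d : nat, d %| 2 * a j + 1 /\ d = 5 %[mod 8]))
  /\
  (forall (t : nat) (p : 'I_t -> nat) (a N m : nat),
     (forall i, prime (p i)) ->
     injective p ->
     0 < a ->
     N = (\prod_(i < t) p i) ^ (2 * a) ->
     N = m ^ 2 ->
     quasiperfect N ->
     [/\ forall q : nat, prime q -> q %| N ->
           q = 1 %[mod 8] \/ q = 7 %[mod 8],
         2 * a + 1 = 3 %[mod 8] /\
         (forall q : nat, prime q -> q %| 2 * a + 1 ->
            q = 1 %[mod 8] \/ q = 3 %[mod 8])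
       & 3 %| 2 * a + 1]).
Proof.
split=> [t p a N m p_pr p_inj a_gt0 -> sqr_m qp | t p a N m p_pr p_inj a_gt0].
  by rewrite sqr_m in qp; apply: (exists_factor_mod4 p_pr p_inj a_gt0 _ qp).
rewrite (big_morph (fun x => x ^ (2 * a)) (id1 := 1) (op1 := muln)); last first.
- exact: exp1n.
- by move=> x y; rewrite expnMn.
move=> -> sqr_m qp; rewrite sqr_m in qp *.
have a_gt0' (i : 'I_t) : 0 < a by [].
have a_const (i : 'I_t) : a = a by [].
have sqr_m' := esym sqr_m; rewrite addn1; split.
- move=> q q_pr /(prime_dvdn_sqr p_pr sqr_m' q_pr)[i ->].
  exact: (factor_mod8 p_pr p_inj a_gt0' sqr_m' qp a_const).
- split=> [|q _].
    by case: (exists_factor_mod8_1 p_pr p_inj a_gt0' sqr_m' qp a_const).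
  exact: (dvdn_exponent_mod8 p_pr p_inj a_gt0' sqr_m' qp a_const).
- exact: (dvdn3_exponent p_pr p_inj a_gt0' sqr_m' qp a_const).
Qed.
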